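(* Consider the DC microgrid $D\dot x = Ax + B_2(u\oslash R_s) + B_1(p_\ell\oslash C_1x)$ and let $\Delta\bar x>0$, $h^{\mathrm o}_+>0$ be given. Suppose a control $u$ is produced by the following procedure. Step 1: by a line search over $\beta>0$ choose a value $\beta>0$ (the largest one found) for which the Co-Design problem (defined in the context) is feasible, let $P\succ0$ be the $P$-component of a solution of it, and set $\mathcal S=\{\Delta x\in\mathbb R^n:\Delta x^\top P\Delta x\le 1\}$. Step 2: compute $\Delta x^C_{\inf}=\inf_{\Delta x\in\mathcal S}C_1\Delta x$ (entrywise infimum). Step 3: compute the vector $x^{Ce}_-\in\mathbb R^{n_\ell}$ with entries $$(x^{Ce}_-)_k=\tfrac12\Big(-(\Delta x^C_{\inf})_k+\sqrt{(\Delta x^C_{\inf})_k^2-4p_{\ell k}/(\beta h^{\mathrm o}_{+,k})}\Big),\qquad k=1,\dots,n_\ell.$$ Step 4: take $u$ from a feasible point $(u,x^e,v^e_\ell,p_s)$ of the Control Synthesis problem $$\min_{u,x^e,v^e_\ell,p_s} c^\top p_s$$ subject to the power flow equations $p_s=[u](Y_{\mathrm{s}\ell}v^e_\ell+Y_{\mathrm{ss}}u)$ and $p_\ell=[v^e_\ell](Y_{\ell\ell}v^e_\ell+Y_{\ell \mathrm s}u)$, $v^e_\ell=C_1x^e$, $u\in\mathcal U$, $x^e\in\mathcal X^e$, $p_s\in\mathcal P_{\mathrm s}$, and the entrywise inequality $C_1x^e\ge x^{Ce}_-$, where $x^e$ is the equilibrium (operating point) of the microgrid under the input $u$. Then, under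 this constant input $u$, the microgrid is transiently stable with a guaranteed ROA; that is, the region of attraction of $x^e$ contains $\mathcal X^{\mathrm o}=[x^e-\Delta\bar x,\;x^e+\Delta\bar x]$.
   Context: Notation: for a vector $v$, $[v]$ is the diagonal matrix with diagonal $v$; $\oslash$ is entrywise division; inequalities between vectors, and $\inf$, $\sup$ of vectors, are entrywise; $v>0$ means all entries are positive; for symmetric matrices $M\preceq N$ means $N-M$ is positive semidefinite. Model: the microgrid has $n_{\mathrm s}$ source buses, $n_\ell$ load buses, $n_{\mathrm t}$ lines, $n=n_{\mathrm s}+n_\ell+n_{\mathrm t}$. The state is $x=[i^\top,v_{\mathrm s}^\top,v_\ell^\top]^\top\in\mathbb R^n$ (line currents, source bus voltages, load bus voltages). $D\in\mathbb R^{n\times n}$ is diagonal with positive diagonal entries (inductances and capacitances); $A\in\mathbb R^{n\times n}$ is the sum of a diagonal matrix with nonpositive diagonal entries and a skew-symmetric matrix; $B_1\in\mathbb R^{n\times n_\ell}$ and $B_2\in\mathbb R^{n\times n_{\mathrm s}}$ are input matrices, $C_1=B_1^\top$, and $C_1x=v_\ell$ extracts the load voltages. $u\in\mathbb R^{n_{\mathrm s}}$ is the constant vector of source voltage set-points, $R_s\in\mathbb R^{n_{\mathrm s}}$ the vector of positive source resistances, $p_\ell\in\mathbb R^{n_\ell}$ the constant vector of constant power load powers with $p_\ell\le0$ (a load with $p_{\ell k}=0$ contributes $0$ to the nonlinear term). $Y_{\mathrm{ss}},Y_{\mathrm s\ell},Y_{\ell\ell}$ are the conductance matrices of the source-source,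 source-load and load-load sub-networks, $Y_{\mathrm s\ell}=Y_{\ell\mathrm s}^\top$. $\mathcal U$, $\mathcal P_{\mathrm s}$ and $\mathcal X^e=\{x^e: x^e_-\le x^e\le x^e_+\}$ are given operational constraint sets and $c\in\mathbb R^{n_{\mathrm s}}_+$ is a cost vector. Operating points (steady-state solutions of the power flow equations) are identified with equilibria, so $x^e$ satisfies $0=Ax^e+B_2(u\oslash R_s)+B_1(p_\ell\oslash C_1x^e)$. The region of attraction (ROA) of $x^e$ is the set of initial states from which the trajectory exists for all future time and converges to $x^e$, $x^e$ being asymptotically stable. Transiently stable with a guaranteed ROA means that the ROA contains $\mathcal X^{\mathrm o}$. Put $\Delta\mathcal X^{\mathrm o}=\{\Delta x\in\mathbb R^n:-\Delta\bar x\le\Delta x\le\Delta\bar x\}$, a box with vertices $\Delta\mathcal X^{\mathrm o}_1,\dots,\Delta\mathcal X^{\mathrm o}_m$, where $\Delta\bar x\in\mathbb R^n$. Co-Design problem (for a fixed parameter $\beta>0$ and fixed $h^{\mathrm o}_+\in\mathbb R^{n_\ell}$, $h^{\mathrm o}_+>0$): maximize $(\det\hat P)^{1/n}$ over symmetric $P\succ0$, $\hat P\in\mathbb R^{n\times n}$, $\gamma\in\mathbb R^n$ with $\gamma>0$, and $\tau>0$, subject to $$(\Delta\mathcal X^{\mathrm o}_k)^\top[\gamma]\,\Delta\mathcal X^{\mathrm o}_k\le1\ \text{ for an arbitrary (one fixed) } k\in\{1,\dots,m\},\qquad P\preceq[\gamma],\qquad \hat P=PD^{-1},$$ $$\begin{bmatrix}\hat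 PA+A^\top\hat P^\top+P & \hat PB_1+\tfrac12\beta\tau C_1^\top[h^{\mathrm o}_+]\\ B_1^\top\hat P^\top+\tfrac12\beta\tau[h^{\mathrm o}_+]C_1 & -\tau I\end{bmatrix}\preceq0 .$$ *)

(* Defs.v *)
From HB Require Import structures.
From mathcomp Require Import all_boot all_order all_algebra.
From mathcomp Require Import all_classical all_reals all_analysis.

Set Implicit Arguments.
Unset Strict Implicit.
Unset Printing Implicit Defensive.

Import Order.TTheory GRing.Theory Num.Theory.
Import numFieldNormedType.Exports.

Local Open Scope classical_set_scope.
Local Open Scope ring_scope.

Section VectorsAndMatrices.
Context {R : realType}.

Definition vle m (x y : 'cV[R]_m) : Prop := forall i, x i 0 <= y i 0.
Definition vpos m (x : 'cV[R]_m) : Prop := forall i, 0 < x i 0.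
Definition vbox m (lo hi : 'cV[R]_m) : set 'cV[R]_m :=
  [set x | vle lo x /\ vle x hi].

Definition vdiag m (v : 'cV[R]_m) : 'M[R]_m := diag_mx v^T.

(* Since x / 0 = 0 in MathComp fields, an entry with zero numerator is 0
   whatever the denominator. *)
Definition vdiv m (x y : 'cV[R]_m) : 'cV[R]_m := map2_mx (fun a b => a / b) x y.

Definition qform m (M : 'M[R]_m) (x : 'cV[R]_m) : R := (x^T *m M *m x) 0 0.
Definition posdef m (M : 'M[R]_m) : Prop :=
  M^T = M /\ forall x, x != 0 -> 0 < qform M x.
Definition possemidef m (M : 'M[R]_m) : Prop :=
  M^T = M /\ forall x, 0 <= qform M x.
Definition loewner_le m (M N : 'M[R]_m) : Prop := possemidef (N - M).

End VectorsAndMatrices.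

(* The state is the column [i; v_s; v_l], of size nt + ns + nl. *)
Record microgrid (R : realType) (ns nl nt : nat) := Microgrid {
  mgD : 'M[R]_(nt + ns + nl);
  mgA : 'M[R]_(nt + ns + nl);
  mgB2 : 'M[R]_(nt + ns + nl, ns);
  mgRs : 'cV[R]_ns;
  mgpl : 'cV[R]_nl;
  mgD_diag : is_diag_mx mgD;
  mgD_pos : forall i, 0 < mgD i i;
  mgA_split : exists (a : 'cV[R]_(nt + ns + nl)) (K : 'M[R]_(nt + ns + nl)),
    [/\ vle a 0, K^T = - K & mgA = vdiag a + K];
  mgRs_pos : vpos mgRs;
  mgpl_le0 : vle mgpl 0
}.

(* C_1 = [0 0 I], so that C_1 x = v_l. *)
Definition loadC (R : realType) (ns nl nt : nat) : 'M[R]_(nl, nt + ns + nl) :=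
  row_mx 0 1%:M.
Definition loadB (R : realType) (ns nl nt : nat) : 'M[R]_(nt + ns + nl, nl) :=
  (loadC R ns nl nt)^T.

Section Dynamics.
Context {R : realType} {ns nl nt : nat}.
Local Notation n := (nt + ns + nl)%N.
Local Notation C1 := (loadC R ns nl nt).
Local Notation B1 := (loadB R ns nl nt).
Variables (g : microgrid R ns nl nt) (u : 'cV[R]_ns).

(* The states at which the constant power load term is meaningful. *)
Definition mg_domain : set 'cV[R]_n :=
  [set x | forall k, mgpl g k 0 != 0 -> (C1 *m x) k 0 != 0].

Definition mg_rhs (x : 'cV[R]_n) : 'cV[R]_n :=
  mgA g *m x + mgB2 g *m vdiv u (mgRs g) + B1 *m vdiv (mgpl g) (C1 *m x).

Definition equilibrium (xe : 'cV[R]_n) : Prop :=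
  mg_domain xe /\ mg_rhs xe = 0.

(* Solutions on [0, +oo[ ; the values of x at negative times are irrelevant. *)
Definition trajectory (x0 : 'cV[R]_n) (x : R -> 'cV[R]_n) : Prop :=
  [/\ x 0 = x0,
      {within [set` `[0, +oo[], continuous x},
      forall t : R, 0 <= t -> mg_domain (x t)
    & forall t : R, 0 < t -> derivable x t 1 /\ mgD g *m derive1 x t = mg_rhs (x t)].

(* The vector field is locally Lipschitz on [mg_domain], so there is at most one
   trajectory from x0; requiring convergence of all of them is the same as
   requiring it of that one. *)
Definition region_of_attraction (xe : 'cV[R]_n) : set 'cV[R]_n :=
  [set x0 | (exists x, trajectory x0 x) /\
            (forall x, trajectory x0 x -> x t @[t --> +oo] --> xe)].

Definition lyapunov_stable (xe : 'cV[R]_n) : Prop :=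
  forall e : R, 0 < e -> exists2 d : R, 0 < d &
    forall x0 x, ball xe d x0 -> trajectory x0 x ->
      forall t : R, 0 <= t -> ball xe e (x t).

Definition asymptotically_stable (xe : 'cV[R]_n) : Prop :=
  [/\ equilibrium xe, lyapunov_stable xe & nbhs xe (region_of_attraction xe)].

Definition transiently_stable (xe : 'cV[R]_n) (X0 : set 'cV[R]_n) : Prop :=
  asymptotically_stable xe /\ X0 `<=` region_of_attraction xe.

End Dynamics.

Record codesign_var (R : realType) (n : nat) := CodesignVar {
  cdP : 'M[R]_n;
  cdPhat : 'M[R]_n;
  cdgamma : 'cV[R]_n;
  cdtau : R
}.

Section CoDesign.
Context {R : realType} {ns nl nt : nat}.
Local Notation n := (nt + ns + nl)%N.
Local Notation C1 := (loadC R ns nl nt).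
Local Notation B1 := (loadB R ns nl nt).
Variables (g : microgrid R ns nl nt) (dxbar : 'cV[R]_n) (hp : 'cV[R]_nl).

(* The vertices of the box [-dxbar, dxbar] are indexed by sign patterns. *)
Definition box_vertex (s : {ffun 'I_n -> bool}) : 'cV[R]_n :=
  \col_i ((-1) ^+ s i * dxbar i 0).

Definition codesign_lmi (beta : R) (z : codesign_var R n) : 'M[R]_(n + nl) :=
  let A := mgA g in
  let Phat := cdPhat z in
  let c := 2^-1 * beta * cdtau z in
  block_mx
    (Phat *m A + A^T *m Phat^T + cdP z)
    (Phat *m B1 + c *: (C1^T *m vdiag hp))
    (B1^T *m Phat^T + c *: (vdiag hp *m C1))
    (- (cdtau z)%:M).

Definition codesign_feasible (k : {ffun 'I_n -> bool}) (beta : R)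
    (z : codesign_var R n) : Prop :=
  [/\ posdef (cdP z), vpos (cdgamma z) & 0 < cdtau z] /\
  [/\ qform (vdiag (cdgamma z)) (box_vertex k) <= 1,
      loewner_le (cdP z) (vdiag (cdgamma z)),
      cdPhat z = cdP z *m invmx (mgD g)
    & loewner_le (codesign_lmi beta z) 0].

Definition codesign_objective (z : codesign_var R n) : R :=
  (\det (cdPhat z)) `^ (n%:R^-1).

Definition codesign_solution (k : {ffun 'I_n -> bool}) (beta : R)
    (z : codesign_var R n) : Prop :=
  codesign_feasible k beta z /\
  forall z', codesign_feasible k beta z' ->
    codesign_objective z' <= codesign_objective z.

(* beta is the largest of the finitely many positive values that were tried for
   which the problem is feasible. *)
Definition line_search_result (k : {ffun 'I_n -> bool}) (tried : seq R)
    (beta : R) : Prop :=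
  let ok b := 0 < b /\ exists z, codesign_feasible k b z in
  [/\ beta \in tried, ok beta & forall b, b \in tried -> ok b -> b <= beta].

Definition ellipsoid (P : 'M[R]_n) : set 'cV[R]_n := [set dx | qform P dx <= 1].

Definition load_dev_inf (P : 'M[R]_n) : 'cV[R]_nl :=
  \col_k inf [set (C1 *m dx) k 0 | dx in ellipsoid P].

Definition load_voltage_lb (beta : R) (P : 'M[R]_n) : 'cV[R]_nl :=
  \col_k (2^-1 * (- load_dev_inf P k 0 +
    Num.sqrt (load_dev_inf P k 0 ^+ 2 - 4 * mgpl g k 0 / (beta * hp k 0)))).

End CoDesign.

Record synthesis_data (R : realType) (ns nl nt : nat) := SynthesisData {
  sdYss : 'M[R]_ns;
  sdYsl : 'M[R]_(ns, nl);
  sdYls : 'M[R]_(nl, ns);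
  sdYll : 'M[R]_nl;
  sdU : set 'cV[R]_ns;
  sdxe_lo : 'cV[R]_(nt + ns + nl);
  sdxe_hi : 'cV[R]_(nt + ns + nl);
  sdPs : set 'cV[R]_ns;
  sdcost : 'cV[R]_ns;
  sdYsl_tr : sdYsl = sdYls^T;
  sdcost_ge0 : vle 0 sdcost
}.

(* The objective c^T p_s, which is minimized, does not enter: any feasible point
   of the problem is accepted. *)
Definition synthesis_feasible (R : realType) (ns nl nt : nat)
    (g : microgrid R ns nl nt) (sd : synthesis_data R ns nl nt)
    (vlb : 'cV[R]_nl) (u : 'cV[R]_ns) (xe : 'cV[R]_(nt + ns + nl))
    (vl : 'cV[R]_nl) (ps : 'cV[R]_ns) : Prop :=
  [/\ ps = vdiag u *m (sdYsl sd *m vl + sdYss sd *m u),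
      mgpl g = vdiag vl *m (sdYll sd *m vl + sdYls sd *m u)
    & vl = loadC R ns nl nt *m xe] /\
  [/\ sdU sd u, vbox (sdxe_lo sd) (sdxe_hi sd) xe, sdPs sd ps
    & vle vlb (loadC R ns nl nt *m xe)].

(* Main.v *)
Require Import Defs.
From HB Require Import structures.
From mathcomp Require Import all_boot all_order all_algebra.
From mathcomp Require Import all_classical all_reals all_analysis.
From mathcomp Require Import ring lra.

Set Implicit Arguments.
Unset Strict Implicit.
Unset Printing Implicit Defensive.

Import Order.TTheory GRing.Theory Num.Theory.
Import numFieldNormedType.Exports.

Local Open Scope classical_set_scope.
Local Open Scope ring_scope.

(** Put y = x - xe and V(y) = y^T P y. The load currents at x and at the
    equilibrium differ by phi_k = h_k w_k, where w = C_1 y and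
    h_k = - p_k / (v_k (v_k + w_k)), v being the equilibrium load voltages.
    The linear matrix inequality of the co-design, tested on the vector
    (y, phi), says that along a solution

        V' <= - V - tau * sum_k phi_k (beta h^o_k w_k - phi_k)

    ([codesign_dissipation]), so V decays exponentially as long as each load
    satisfies the sector condition 0 <= h_k <= beta h^o_k. On the ellipsoid
    V <= 1 the voltage v_k + w_k is at least a_k = v_k + m_k, where m_k <= 0 is
    the infimum of w_k over the ellipsoid. The lower bound on v_k from the
    synthesis step is the larger root of
    v_k (v_k + m_k) = - p_k / (beta h^o_k); above it the sector condition holds
    at the worst point of the ellipsoid, hence throughout
    ([load_voltage_margin], [load_sector]).
    The box of initial states lies in the ellipsoid since P <= [gamma]
    ([box_sub_ellipsoid]).

    Two points need more than this computation. A trajectory that starts on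
    the boundary of the ellipsoid must be shown to stay inside: at a last time
    with V <= 1 the bound on V' is continuous and strictly negative, so V
    cannot rise above 1 ([confined_sublevel]). And a trajectory must exist for
    all time although the vector field is singular at zero voltage: freezing
    each load current below the voltage a_k gives a globally Lipschitz field
    ([cutoff_current]) which obeys the same sector condition everywhere. It has
    a global solution by Picard iteration ([lipschitz_global_solution]), this
    solution stays in the ellipsoid, and there the two fields agree. *)

(** * Continuity and derivatives of matrix-valued functions *)
Section MatrixCalculus.
Context {R : realType}.

Lemma ler_coord_norm m n (M : 'M[R]_(m, n)) i j : `|M i j| <= `|M|.
Proof.
rewrite [leRHS]/Num.Def.normr/= mx_normrE.
by apply: (le_trans _ (le_bigmax _ _ (i, j))).
Qed.

Lemma ler_mx_norm m n (M : 'M[R]_(m, n)) (e : R) : 0 <= e ->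
  (forall i j, `|M i j| <= e) -> `|M| <= e.
Proof.
move=> e0 Me; rewrite [leLHS]/Num.Def.normr/= mx_normrE.
by rewrite (bigmax_le _ e0)// => -[i j] _.
Qed.

Lemma continuous_col {T : topologicalType} n (f : 'I_n -> T -> R) t :
  (forall i, {for t, continuous (f i)}) ->
  {for t, continuous (fun x => \col_i f i x)}.
Proof.
move=> ft; apply/cvgrPdist_le => /= e e0.
near=> x.
apply: ler_mx_norm => [|i j]; first exact: ltW.
rewrite !mxE/=.
move: i {j}; near: x; apply: filter_forall => i.
by move/cvgrPdist_le : (ft i) => /(_ _ e0).
Unshelve. all: by end_near. Qed.

Lemma continuous_coord {T : topologicalType} m n (M : T -> 'M[R]_(m, n)) t i j :
  {for t, continuous M} -> {for t, continuous (fun x => M x i j)}.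
Proof.
move=> Mt; apply: (@continuous_comp _ _ _ M (fun N => N i j)) => //.
exact: coord_continuous.
Qed.

Lemma lipschitz_comp_continuous {T : topologicalType} (V W : normedModType R)
    (f : V -> W) (L : R) (x : T -> V) t :
  (forall a b, `|f a - f b| <= L * `|a - b|) -> {for t, continuous x} ->
  {for t, continuous (fun s => f (x s))}.
Proof.
move=> fL cx; apply/cvgrPdist_le => /= e e0.
have L1 : 0 < `|L| + 1 by rewrite ltr_wpDl.
have := cx => /cvgrPdist_le/(_ (e / (`|L| + 1))); rewrite divr_gt0// => /(_ isT).
apply: filterS => s xs; apply: (le_trans (fL _ _)).
apply: (@le_trans _ _ ((`|L| + 1) * `|x t - x s|)).
  by rewrite ler_wpM2r// (le_trans (ler_norm _))// lerDl.
by rewrite mulrC -ler_pdivlMr.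
Qed.

Lemma is_derive_mxP m n (M : R -> 'M[R]_(m, n)) (t : R) (dM : 'M[R]_(m, n)) :
  is_derive t 1 M dM <->
  forall i j, is_derive t 1 (fun x => M x i j) (dM i j).
Proof.
split=> [[dMt <-] i j|dMt].
  apply: DeriveDef; first exact: (derivable_mxP _ _ _).1.
  by rewrite derive_mx// mxE.
have dM' : derivable M t 1 by apply/derivable_mxP => i j; case: (dMt i j).
apply: DeriveDef => //; rewrite derive_mx//.
by apply/matrixP => i j; rewrite mxE; case: (dMt i j).
Qed.

Lemma is_derive_col n (f : 'I_n -> R -> R) (t : R) (df : 'cV[R]_n) :
  (forall i, is_derive t 1 (f i) (df i 0)) ->
  is_derive t 1 (fun x => \col_i f i x) df.
Proof.
move=> dft; apply/is_derive_mxP => i j; rewrite ord1.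
rewrite (_ : (fun x => _) = f i)//.
by apply/funext => x; rewrite mxE.
Qed.

Lemma is_derive_continuous (V : normedModType R) (f : R -> V) (t : R) df :
  is_derive t 1 f df -> {for t, continuous f}.
Proof.
by move=> [dft _]; apply/differentiable_continuous/derivable1_diffP.
Qed.

End MatrixCalculus.

(** * Primitives of vector-valued functions *)
Section Primitive.
Context {R : realType}.

(** Integrating from -1 rather than from 0 makes 0 an interior point, so that
    the primitive is differentiable, hence continuous, at 0 too. *)
Lemma primitive_exists (g : R -> R) : continuous g ->
  exists2 G : R -> R, G 0 = 0 & forall t : R, -1 < t -> is_derive t 1 G (g t).
Proof.
move=> cg.
pose F (x : R) := (\int[@lebesgue_measure R]_(t in [set` `[(-1)%R, x]]) (g t))%R.
exists (fun t => F t - F 0); first by rewrite subrr.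
move=> t t1; rewrite -[g t]subr0.
suff [dF Ft] : derivable F t 1 /\ derive1 F t = g t.
  have dFt : is_derive t 1 F (g t) by apply: DeriveDef; rewrite -?derive1E.
  exact: (is_deriveB dFt (is_derive_cst (F 0) t 1)).
apply: (@continuous_FTC1_closed _ _ _ _ (t + 1)) => //; first by rewrite ltrDl.
  apply: continuous_compact_integrable; first exact: segment_compact.
  exact: continuous_subspaceT.
exact: cg.
Qed.

(** Composing with t |-> max(t, 0) turns a function that is only known on
    [0, +oo[ into one that is continuous on the whole line, without changing
    its derivative at positive times. *)
Lemma continuous_clamp : continuous (fun t : R => Num.max t 0).
Proof.
by move=> t; apply: (@continuous_max R R idfun (cst 0) t) => //; exact: cvg_cst.
Qed.

Lemma near_clamp (t : R) : 0 < t -> \near t, t = Num.max t 0.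
Proof.
move=> t0; near=> s; rewrite max_l//.
by apply: ltW; near: s; exact: lt_nbhsr.
Unshelve. all: by end_near. Qed.

(** The primitive is frozen at negative times, so that it can be fed back as an
    integrand in Picard iteration. *)
Lemma vector_primitive_exists n (a : 'cV[R]_n) (g : R -> 'cV[R]_n) :
  continuous g -> exists G : R -> 'cV[R]_n,
  [/\ continuous G, forall t : R, t <= 0 -> G t = a &
      forall t : R, 0 < t -> is_derive t 1 G (g t)].
Proof.
move=> cg.
have /choice[G GP] i : exists G : R -> R, G 0 = 0 /\
    forall t : R, -1 < t -> is_derive t 1 G (g t i 0).
  have [|G G0 dG] := @primitive_exists (fun t => g t i 0); last by exists G.
  by move=> t; exact: continuous_coord (cg t).
exists (fun t => \col_i (a i 0 + G i (Num.max t 0))); split.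
- move=> t; apply: continuous_col => i.
  apply: cvgD; first exact: cvg_cst.
  apply: (continuous_comp (@continuous_clamp t)).
  apply: is_derive_continuous; apply: (GP i).2.
  by rewrite (@lt_le_trans _ _ 0)// ?ltrN10// le_max lexx orbT.
- move=> t t0; apply/colP => i; rewrite mxE max_r//.
  by rewrite (GP i).1 addr0.
- move=> t t0; apply: is_derive_col => i; rewrite -[g t i 0]add0r.
  apply: is_deriveD.
  apply: (@near_eq_is_derive _ _ _ (G i)).
  + by near=> s; rewrite -(near (near_clamp t0) s).
  + by apply: (GP i).2; rewrite (lt_trans _ t0)// ltrN10.
Unshelve. all: by end_near. Qed.

Lemma derive_ge0_le (h dh : R -> R) (a b : R) : a <= b ->
  continuous h ->
  (forall t : R, a < t < b -> is_derive t 1 h (dh t) /\ 0 <= dh t) ->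
  h a <= h b.
Proof.
rewrite le_eqVlt => /predU1P[->//|ab] ch dhP.
have [|//|c /=] := @MVT R h dh a b ab.
- by move=> t; rewrite in_itv/= => /dhP[].
- exact: continuous_subspaceT.
- rewrite in_itv/= => /dhP[_ dc0] hE.
  by rewrite -subr_ge0 hE mulr_ge0// subr_ge0 ltW.
Qed.

(** In the norm sup_t e^(-ct) |w(t)|, integration from 0 has operator norm at
    most 1/c. This weight makes the Picard map a contraction on the whole
    half-line at once, with no gluing of local solutions. *)
Lemma exp_growth_bound n (w dw : R -> 'cV[R]_n) (K c : R) :
  0 <= K -> 0 < c -> continuous w -> w 0 = 0 ->
  (forall t : R, 0 < t -> is_derive t 1 w (dw t)) ->
  (forall t : R, 0 < t -> `|dw t| <= K * c * expR (c * t)) ->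
  forall t : R, 0 <= t -> `|w t| <= K * expR (c * t).
Proof.
move=> K0 c0 cw w0 dwt dwK t t0.
have dexp (s : R) : is_derive s 1 (fun s : R => K * expR (c * s)) (K * c * expR (c * s)).
  have h : is_derive s 1 (c \*: idfun : R -> R) c.
    by have := is_deriveZ c (is_derive_id s (1 : R)); rewrite /GRing.scale/= mulr1.
  have := is_deriveZ K (is_derive1_comp (is_derive_expR _) h).
  by rewrite /GRing.scale/= mulrA => ?; rewrite mulrAC.
have Kt0 : 0 <= K * expR (c * t) by rewrite mulr_ge0// expR_ge0.
(* K e^(ct) - w_i and K e^(ct) + w_i are nondecreasing, since |w_i'| is at most
   the derivative of K e^(ct). *)
suff H (eps : R) i : `|eps| = 1 -> K <= K * expR (c * t) + eps * w t i 0.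
  apply: ler_mx_norm => // i j; rewrite ord1 ler_norml.
  have := H 1 i; have := H (-1) i; rewrite normrN normr1 => /(_ erefl) + /(_ erefl).
  by move: K0; lra.
move=> eps1.
pose h s := K * expR (c * s) + eps * w s i 0.
have h0 : h 0 = K by rewrite /h w0 mxE !mulr0 expR0 mulr1 addr0.
rewrite -{1}h0 -[leRHS]/(h t).
apply: (@derive_ge0_le h (fun s => K * c * expR (c * s) + eps * dw s i 0) 0 t t0).
  move=> s; apply: cvgD; first exact: (is_derive_continuous (dexp s)).
  apply: cvgM; first exact: cvg_cst.
  by apply: continuous_coord; exact: cw.
move=> s /andP[s0 _]; split.
  apply: is_deriveD.
  have := dwt _ s0 => /is_derive_mxP/(_ i 0).
  by exact: (is_deriveZ eps).
have : `|eps * dw s i 0| <= K * c * expR (c * s).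
  by rewrite normrM eps1 mul1r (le_trans (ler_coord_norm _ _ _))// dwK.
by rewrite ler_norml; lra.
Qed.
End Primitive.

(** * Global solutions of Lipschitz differential equations *)
Section GlobalSolution.
Context {R : realType}.

(** The intervals of centre u_m and radius 2 C / 2^m are nested; the supremum of
    their left ends lies in all of them. *)
Lemma geometric_limit (u : nat -> R) (C : R) :
  (forall m, `|u m.+1 - u m| <= C / 2 ^+ m) ->
  exists l, forall m, `|l - u m| <= 2 * C / 2 ^+ m.
Proof.
move=> uC.
have hE m : C / 2 ^+ m = 2 * (C / 2 ^+ m.+1).
  by rewrite exprS invfM; field; rewrite expf_neq0.
have lo m p : u m - 2 * C / 2 ^+ m <= u (m + p)%N - 2 * C / 2 ^+ (m + p).
  elim: p => [|p /le_trans]; first by rewrite addn0.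
  apply; rewrite addnS; have := uC (m + p)%N; have := hE (m + p)%N.
  by rewrite ler_norml -!mulrA; lra.
have hi m p : u (m + p)%N + 2 * C / 2 ^+ (m + p) <= u m + 2 * C / 2 ^+ m.
  elim: p => [|p]; first by rewrite addn0.
  apply: le_trans; rewrite addnS; have := uC (m + p)%N; have := hE (m + p)%N.
  by rewrite ler_norml -!mulrA; lra.
have C0 m : 0 <= 2 * C / 2 ^+ m.
  by have := uC m; have := normr_ge0 (u m.+1 - u m); rewrite -mulrA; lra.
have lohi p m : u p - 2 * C / 2 ^+ p <= u m + 2 * C / 2 ^+ m.
  apply: (le_trans (lo p m)); apply: le_trans (hi m p).
  by rewrite addnC; have := C0 (m + p)%N; lra.
pose A := range (fun p => u p - 2 * C / 2 ^+ p).
have A0 : A !=set0 by exists (u 0%N - 2 * C / 2 ^+ 0), 0%N.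
exists (sup A) => m; rewrite ler_distl; apply/andP; split.
  apply: ub_le_sup; last by exists m.
  by exists (u 0%N + 2 * C / 2 ^+ 0) => _ [p _ <-]; exact: lohi.
by apply: ge_sup => // _ [p _ <-]; exact: lohi.
Qed.

Lemma geometric_small (K e : R) : 0 < e -> exists m, K / 2 ^+ m < e.
Proof.
move=> e0.
have /cvgrPdist_lt/(_ e e0) : K * 2^-1 ^+ m @[m --> \oo] --> 0.
  by apply: (@cvg_geometric R K 2^-1); rewrite gtr0_norm// invf_lt1// ltr1n.
case=> m _ /(_ m (leqnn m)); rewrite sub0r normrN => h; exists m.
by rewrite -exprVn (le_lt_trans (ler_norm _)).
Qed.

Lemma vector_geometric_limit n (u : nat -> 'cV[R]_n) (C : R) : 0 <= C ->
  (forall m, `|u m.+1 - u m| <= C / 2 ^+ m) ->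
  exists l, forall m, `|l - u m| <= 2 * C / 2 ^+ m.
Proof.
move=> C0 uC.
have /choice[l lP] i : exists l, forall m, `|l - u m i 0| <= 2 * C / 2 ^+ m.
  apply: geometric_limit => m; apply: le_trans (uC m).
  by apply: le_trans (ler_coord_norm _ i 0); rewrite !mxE.
exists (\col_i l i) => m; apply: ler_mx_norm => [|i j].
  by rewrite divr_ge0 ?mulr_ge0// exprn_ge0.
by rewrite ord1 !mxE.
Qed.

(** With the weight e^(2Lt) the Picard map halves distances, so the iterates
    converge geometrically, uniformly on bounded time intervals; the limit is
    continuous and is a fixed point. *)
Theorem lipschitz_global_solution n (f : 'cV[R]_n -> 'cV[R]_n) (L : R) :
  (forall a b, `|f a - f b| <= L * `|a - b|) ->
  forall x0, exists x : R -> 'cV[R]_n,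
  [/\ continuous x, x 0 = x0 & forall t : R, 0 < t -> is_derive t 1 x (f (x t))].
Proof.
move=> fL x0.
wlog L0 : L fL / 0 < L.
  move=> /(_ (`|L| + 1)); apply; last by rewrite ltr_wpDl.
  move=> a b; apply: (le_trans (fL _ _)).
  by rewrite ler_wpM2r// (le_trans (ler_norm _))// lerDl.
have cf (x : R -> 'cV[R]_n) : continuous x -> continuous (f \o x).
  by move=> cx t; exact: lipschitz_comp_continuous fL (cx t).
have /choice[T TP] (x : R -> 'cV[R]_n) : exists G : R -> 'cV[R]_n,
    continuous x -> [/\ continuous G, forall t : R, t <= 0 -> G t = x0 &
      forall t : R, 0 < t -> is_derive t 1 G (f (x t))].
  have [cx|ncx] := pselect (continuous x); last by exists x.
  by have [G GP] := vector_primitive_exists x0 (cf _ cx); exists G.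
have [c c0 cL] : exists2 c : R, 0 < c & c = 2 * L.
  by exists (2 * L) => //; rewrite mulr_gt0.
(* T is the Picard map. Its Lipschitz constant for the weight e^(ct) is L/c = 1/2. *)
have T_contr (x y : R -> 'cV[R]_n) K : continuous x -> continuous y -> 0 <= K ->
    (forall t : R, 0 <= t -> `|x t - y t| <= 2 * K * expR (c * t)) ->
    forall t : R, 0 <= t -> `|T x t - T y t| <= K * expR (c * t).
  move=> cx cy K0 xyK.
  have [cTx Tx0 dTx] := TP _ cx; have [cTy Ty0 dTy] := TP _ cy.
  apply: (exp_growth_bound (dw := fun t => f (x t) - f (y t))) => //.
  - by move=> t; apply: cvgB; [exact: cTx|exact: cTy].
  - by rewrite Tx0// Ty0// subrr.
  - by move=> t t0; apply: is_deriveB; [exact: dTx|exact: dTy].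
  - move=> t t0; apply: (le_trans (fL _ _)).
    have := xyK _ (ltW t0); rewrite -(ler_pM2l L0) => /le_trans; apply.
    by rewrite cL; lra.
pose u := fix u m := if m is m'.+1 then T (u m') else fun=> x0.
have cu m : continuous (u m).
  elim: m => [t|m IHm]; first exact: cvg_cst.
  by case: (TP _ IHm).
have u_le0 m t : t <= 0 -> u m t = x0.
  by case: m => //= m t0; case: (TP _ (cu m)) => _ + _; exact.
have [M M0 MfE] : exists2 M : R, 0 <= M & M * c = `|f x0|.
  by exists (`|f x0| / c); rewrite ?divfK ?gt_eqF// divr_ge0// ltW.
have uM m t : 0 <= t -> `|u m.+1 t - u m t| <= M * expR (c * t) / 2 ^+ m.
  elim: m t => [t t0|m IHm t t0].
    rewrite expr0 divr1 /=.
    have [cT T0 dT] := TP _ (cu 0%N).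
    have {}t0 := t0; move: t t0.
    apply: (exp_growth_bound (dw := fun t => f x0 - 0)) => //.
    - by move=> t; apply: cvgB; [exact: cT|exact: cvg_cst].
    - by rewrite T0// subrr.
    - by move=> t t0; apply: is_deriveB; exact: dT.
    - move=> t t0; rewrite subr0 MfE.
      by rewrite ler_peMr// -expR0 ler_expR mulr_ge0// ltW.
  rewrite mulrAC; apply: (T_contr _ _ _ (cu m.+1) (cu m)) t t0.
    by rewrite divr_ge0// exprn_ge0.
  move=> t /IHm /le_trans; apply; rewrite exprS invfM.
  by rewrite le_eqVlt; apply/orP; left; apply/eqP; field; rewrite expf_neq0.
have /choice[U0 U0P] t : exists l, 0 <= t -> forall m,
    `|l - u m t| <= 2 * (M * expR (c * t)) / 2 ^+ m.
  have [t0|t0] := leP 0 t; last by exists 0.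
  have [||l lP] := @vector_geometric_limit _ (u ^~ t) (M * expR (c * t)).
  - by rewrite mulr_ge0// expR_ge0.
  - by move=> m; exact: uM.
  - by exists l.
pose U t := U0 (Num.max t 0).
have U_ge0 t : 0 <= t -> U t = U0 t by move=> t0; rewrite /U max_l.
have UP t m : 0 <= t -> `|U t - u m t| <= 2 * (M / 2 ^+ m) * expR (c * t).
  move=> t0; rewrite U_ge0//; apply: (le_trans (U0P t t0 m)).
  by rewrite le_eqVlt; apply/orP; left; apply/eqP; ring.
have U_le0 t : t <= 0 -> U t = x0.
  move=> t0; rewrite /U max_r//; apply/eqP; rewrite -subr_eq0 -normr_le0.
  apply/ler_addgt0Pl => e e0; rewrite addr0.
  have [m mP] := geometric_small (2 * M) e0.
  have := U0P 0 (lexx _) m; rewrite u_le0// mulr0 expR0 mulr1 => /le_trans; apply.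
  exact: ltW.
have U_clamp t m : `|U t - u m t| <= 2 * (M / 2 ^+ m) * expR (c * Num.max t 0).
  have [t0|t0] := leP 0 t; first by rewrite UP.
  rewrite (U_le0 _ (ltW t0)) (u_le0 _ _ (ltW t0)) subrr normr0.
  by rewrite !(mulr_ge0, expR_ge0, invr_ge0, exprn_ge0, M0, ler0n).
have cU : continuous U.
  move=> t; apply/cvgrPdist_le => /= e e0.
  (* The iterates converge uniformly on ]-oo, t + 1], a neighbourhood of t. *)
  pose E := expR (c * Num.max (t + 1) 0).
  have [m mP] := geometric_small (2 * M * E) (divr_gt0 e0 (ltr0n R 3)).
  have E_le s : s <= t + 1 -> `|U s - u m s| <= e / 3.
    move=> st; apply: (le_trans (U_clamp _ _)).
    apply: le_trans (ltW mP); rewrite -!mulrA ler_wpM2l// ler_wpM2l// mulrC.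
    rewrite ler_wpM2r ?invr_ge0 ?exprn_ge0// ler_expR ler_pM2l//.
    by rewrite ge_max le_max st/= le_max lexx orbT.
  have := cu m t => /cvgrPdist_le/(_ _ (divr_gt0 e0 (ltr0n R 3))) ut.
  near=> s.
  have -> : U t - U s = (U t - u m t) + (u m t - u m s) - (U s - u m s).
    by rewrite subrKA opprB addrA subrK.
  apply: (le_trans (ler_normB _ _)).
  have := ler_normD (U t - u m t) (u m t - u m s).
  have := E_le t; rewrite lerDl => /(_ ler01).
  have : `|u m t - u m s| <= e / 3 by near: s.
  have := E_le s; have -> : s <= t + 1.
    by apply: ltW; near: s; apply: lt_nbhsl; rewrite ltrDl.
  by move=> /(_ isT); lra.
have [cT T0 dT] := TP _ cU.
suff TU : T U = U.
  by exists U; split => // [|t t0]; [exact: U_le0|rewrite -{1}TU; exact: dT].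
apply/funext => t.
have [t0|t0] := leP t 0; first by rewrite T0// U_le0.
apply/eqP; rewrite -subr_eq0 -normr_le0; apply/ler_addgt0Pl => e e0; rewrite addr0.
have [m mP] := geometric_small (2 * M * expR (c * t)) e0.
have h1 : `|T U t - u m.+1 t| <= M / 2 ^+ m * expR (c * t).
  apply: (T_contr _ _ _ cU (cu m)) (ltW t0).
    by rewrite divr_ge0// exprn_ge0.
  by move=> s s0; exact: UP.
have := UP t m.+1 (ltW t0).
have := ler_normB (T U t - u m.+1 t) (U t - u m.+1 t).
rewrite opprB subrKA => h2 h3.
have h4 : 2 * (M / 2 ^+ m.+1) = M / 2 ^+ m.
  by rewrite exprS invfM; field; rewrite expf_neq0.
move: h3 mP; rewrite h4 -!mulrA (mulrC (expR _)); move: h1 h2; rewrite -!mulrA; lra.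
Unshelve. all: by end_near. Qed.
End GlobalSolution.

(** * Quadratic forms *)
Section QuadraticForms.
Context {R : realType}.

Lemma cvg_sum {T : Type} (F : set_system T) {FF : Filter F} n
    (f : 'I_n -> T -> R) (l : 'I_n -> R) :
  (forall i, f i x @[x --> F] --> l i) ->
  (\sum_(i < n) f i x) @[x --> F] --> \sum_(i < n) l i.
Proof. by move=> fl; apply: cvg_big => //; exact: add_continuous. Qed.

Lemma qformE n (P : 'M[R]_n) x :
  qform P x = \sum_i x i 0 * (P *m x) i 0.
Proof.
by rewrite /qform -mulmxA mxE; apply: eq_bigr => i _; rewrite mxE.
Qed.

Lemma bilin_sym n (P : 'M[R]_n) (x y : 'cV[R]_n) : P^T = P ->
  (x^T *m P *m y) 0 0 = (y^T *m P *m x) 0 0.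
Proof.
move=> PT; have -> : x^T *m P *m y = (y^T *m P *m x)^T.
  by rewrite !trmx_mul trmxK PT mulmxA.
by rewrite mxE.
Qed.

Lemma qformD n (P : 'M[R]_n) (x y : 'cV[R]_n) (s : R) : P^T = P ->
  qform P (x + s *: y) =
  qform P x + 2 * s * (y^T *m P *m x) 0 0 + s ^+ 2 * qform P y.
Proof.
move=> PT; have xyT : (x + s *: y)^T = x^T + s *: y^T.
  by apply/matrixP => i j; rewrite !mxE.
rewrite /qform xyT !mulmxDl !mulmxDr.
rewrite -!scalemxAl -!scalemxAr.
have := bilin_sym x y PT.
have D (A B : 'M[R]_1) : (A + B) 0 0 = A 0 0 + B 0 0 by rewrite mxE.
have Z a (A : 'M[R]_1) : (a *: A) 0 0 = a * A 0 0 by rewrite mxE.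
by rewrite !(D, Z) => ->; ring.
Qed.

Lemma qform_ge0 n (P : 'M[R]_n) x : posdef P -> 0 <= qform P x.
Proof.
move=> [_ P0]; have [->|/P0/ltW//] := eqVneq x 0.
by rewrite /qform mulmx0 mxE.
Qed.

Lemma posdef_unitmx n (P : 'M[R]_n) : posdef P -> P \in unitmx.
Proof.
move=> [_ P0]; rewrite unitmxE unitfE; apply/negP => /det0P[v v0 vP].
have : v^T != 0 by rewrite -trmx0 (inj_eq trmx_inj).
by move=> /P0; rewrite /qform trmxK vP mul0mx mxE ltxx.
Qed.

(** Cauchy-Schwarz for the inner product of P: the i-th coordinate of x is the
    inner product of x with e_i = P^-1 delta_i. *)
Lemma posdef_coord_bound n (P : 'M[R]_n) : posdef P ->
  exists2 c : R, 0 < c & forall (x : 'cV[R]_n) i, x i 0 ^+ 2 <= c * qform P x.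
Proof.
move=> Ppd; have Pu := posdef_unitmx Ppd; have [PT _] := Ppd.
pose e i : 'cV[R]_n := invmx P *m delta_mx i 0.
have eP i x : ((e i)^T *m P *m x) 0 0 = x i 0.
  rewrite /e trmx_mul trmx_inv PT mulmxKV// trmx_delta.
  by rewrite -rowE mxE.
have e0 i : 0 <= qform P (e i) by exact: qform_ge0.
(* One constant c > 0 above all qform P (e i), so that no case distinction on
   e i = 0 arises when minimizing over the multiple of e i. *)
pose c := 1 + \sum_i qform P (e i).
have s0 : 0 <= \sum_i qform P (e i) by rewrite sumr_ge0.
have c0 : 0 < c by rewrite ltr_pwDl.
exists c => // x i.
have ec : qform P (e i) <= c.
  by rewrite /c (bigD1 i)//= addrCA lerDl addr_ge0// sumr_ge0.
have := qform_ge0 (x + (- (x i 0 / c)) *: e i) Ppd.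
rewrite qformD// eP sqrrN.
have : (x i 0 / c) ^+ 2 * qform P (e i) <= (x i 0 / c) ^+ 2 * c.
  by rewrite ler_wpM2l// sqr_ge0.
have -> : (x i 0 / c) ^+ 2 * c = x i 0 ^+ 2 / c by field; rewrite gt_eqF.
have -> : 2 * - (x i 0 / c) * x i 0 = - 2 * (x i 0 ^+ 2 / c).
  by field; rewrite gt_eqF.
move=> h1 h2; have : x i 0 ^+ 2 / c <= qform P x by lra.
by rewrite ler_pdivrMr// mulrC.
Qed.

Lemma posdef_norm_bound n (P : 'M[R]_n) : posdef P ->
  exists2 c : R, 0 < c & forall x : 'cV[R]_n, `|x| ^+ 2 <= c * qform P x.
Proof.
move=> Ppd; have [c c0 cP] := posdef_coord_bound Ppd; exists c => // x.
have cV0 : 0 <= c * qform P x := mulr_ge0 (ltW c0) (qform_ge0 _ Ppd).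
rewrite -[leRHS]sqr_sqrtr// lerXn2r ?nnegrE ?sqrtr_ge0//.
apply: ler_mx_norm; first exact: sqrtr_ge0.
by move=> i j; rewrite ord1 -sqrtr_sqr ler_wsqrtr.
Qed.

Lemma mulmx_bound m n (A : 'M[R]_(m, n)) :
  exists2 K : R, 0 <= K & forall x : 'cV[R]_n, `|A *m x| <= K * `|x|.
Proof.
exists (\sum_i \sum_j `|A i j|) => [|x]; first by rewrite !sumr_ge0// => ? _; rewrite sumr_ge0.
apply: ler_mx_norm => [|i j].
  by rewrite mulr_ge0// sumr_ge0// => ? _; rewrite sumr_ge0.
rewrite ord1 mxE; apply: (le_trans (ler_norm_sum _ _ _)).
apply: (@le_trans _ _ ((\sum_j `|A i j|) * `|x|)).
  by rewrite mulr_suml ler_sum// => k _; rewrite normrM ler_wpM2l// ler_coord_norm.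
rewrite ler_wpM2r// (bigD1 i)//= lerDl sumr_ge0// => ? _.
by rewrite sumr_ge0.
Qed.

Lemma qform_norm_bound n (P : 'M[R]_n) :
  exists2 C : R, 0 < C & forall x : 'cV[R]_n, qform P x <= C * `|x| ^+ 2.
Proof.
have [K K0 KP] := mulmx_bound P.
exists (n%:R * K + 1) => [|x]; first by rewrite ltr_wpDl// mulr_ge0.
rewrite qformE.
apply: (@le_trans _ _ (\sum_(i < n) `|x| * (K * `|x|))).
  apply: ler_sum => i _; apply: (le_trans (ler_norm _)); rewrite normrM.
  by rewrite ler_pM// ?ler_coord_norm// (le_trans (ler_coord_norm _ _ _)).
rewrite sumr_const card_ord -mulr_natl expr2 mulrDl mul1r.
by have := mulr_ge0 (normr_ge0 x) (normr_ge0 x); lra.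
Qed.

Lemma qform_vdiag n (v x : 'cV[R]_n) :
  qform (vdiag v) x = \sum_i v i 0 * x i 0 ^+ 2.
Proof.
rewrite qformE; apply: eq_bigr => i _.
by rewrite /vdiag mul_diag_mx !mxE; ring.
Qed.

Lemma continuous_mulmx {T : topologicalType} m n (A : 'M[R]_(m, n))
    (x : T -> 'cV[R]_n) t :
  {for t, continuous x} -> {for t, continuous (fun s => A *m x s)}.
Proof.
have [K _ KP] := mulmx_bound A.
by apply: (lipschitz_comp_continuous (L := K)) => a b; rewrite -mulmxBr.
Qed.

Lemma continuous_qform {T : topologicalType} n (P : 'M[R]_n)
    (x : T -> 'cV[R]_n) t :
  {for t, continuous x} -> {for t, continuous (fun s => qform P (x s))}.
Proof.
move=> xt; rewrite /prop_for/continuous_at qformE.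
rewrite (_ : (fun s => _) = fun s => \sum_i x s i 0 * (P *m x s) i 0); last first.
  by apply/funext => s; rewrite qformE.
apply: cvg_sum => i; apply: cvgM.
  exact: (@continuous_coord _ _ _ _ x t i 0 xt).
exact: (@continuous_coord _ _ _ _ _ t i 0 (continuous_mulmx (A := P) xt)).
Qed.

Lemma is_derive_mulmx m n (A : 'M[R]_(m, n)) (x : R -> 'cV[R]_n) (t : R) dx :
  is_derive t 1 x dx -> is_derive t 1 (fun s => A *m x s) (A *m dx).
Proof.
move=> /is_derive_mxP xt; apply/is_derive_mxP => i j; rewrite ord1 mxE.
rewrite (_ : (fun s => _) = \sum_k (A i k \*: (fun s => x s k 0))); last first.
  by apply/funext => s; rewrite mxE fct_sumE.
by apply: is_derive_sum => k; exact: is_deriveZ.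
Qed.

Lemma is_derive_qform n (P : 'M[R]_n) (x : R -> 'cV[R]_n) (t : R) dx :
  P^T = P -> is_derive t 1 x dx ->
  is_derive t 1 (fun s => qform P (x s)) (2 * ((x t)^T *m P *m dx) 0 0).
Proof.
move=> PT xt; have Pxt := is_derive_mulmx P xt.
rewrite (_ : (fun s => _) =
    \sum_i ((fun s => x s i 0) * (fun s => (P *m x s) i 0))); last first.
  by apply/funext => s; rewrite qformE fct_sumE.
rewrite (_ : 2 * _ = \sum_i (x t i 0 *: (P *m dx) i 0 + (P *m x t) i 0 *: dx i 0)).
  apply: is_derive_sum => i; apply: is_deriveM.
  - exact: (is_derive_mxP _ _ _).1.
  - exact: (is_derive_mxP _ _ _).1.
rewrite mulrDl mul1r {2}(bilin_sym _ _ PT) big_split/=; congr (_ + _).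
  by rewrite -mulmxA mxE; apply: eq_bigr => i _; rewrite mxE.
rewrite -mulmxA mxE; apply: eq_bigr => i _; rewrite mxE.
by rewrite /GRing.scale/= mulrC.
Qed.
End QuadraticForms.

(** * Decay of a Lyapunov function on a sublevel set *)
Section Decay.
Context {R : realType}.

(** Suppose V(t) > 1, and let s be the last time before t with V <= 1. If
    V(s) < 1, continuity contradicts maximality. Otherwise E(s) >= V(s) = 1 > 0, hence V' <= - E < 0
    just after s, and V stays below 1 there: again a contradiction. The lower
    bound V <= E is available only on the sublevel set, and continuity of E
    carries its sign slightly beyond. *)
Lemma confined_sublevel (V E dV : R -> R) :
  continuous V -> continuous E ->
  (forall t : R, 0 < t -> is_derive t 1 V (dV t)) ->
  (forall t : R, 0 < t -> dV t <= - E t) ->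
  (forall t : R, 0 <= t -> V t <= 1 -> V t <= E t) ->
  V 0 <= 1 -> forall t : R, 0 <= t -> V t <= 1.
Proof.
move=> cV cE dVt dVE VE V01 t t0; rewrite leNgt; apply/negP => Vt1.
pose A : set R := [set s | 0 <= s <= t /\ V s <= 1].
have A0 : A 0 by rewrite /A/= lexx t0.
have At : ubound A t by move=> s [/andP[_ ]].
have supA : has_sup A by split; [exists 0|exists t].
pose s := sup A.
have s0 : 0 <= s by apply: ub_le_sup => //; exists t.
have st : s <= t by apply: ge_sup => //; exists 0.
have Vs : V s <= 1.
  rewrite leNgt; apply/negP => Vs1.
  have /nbhs_ballP[d /= d0 dV1] : \forall r \near s, 1 < V r.
    exact: (cvgr_gt _ (cV s)).
  have [r [r0 Vr] rs] := sup_adherent d0 supA.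
  have rs' : r <= s by apply: ub_le_sup => //; exists t.
  have := dV1 r; rewrite /ball/= ger0_norm ?subr_ge0// => /(_ _).
  by rewrite ltrBlDr addrC -ltrBlDr => /(_ rs); rewrite ltNge Vr.
have Ahi r : s < r <= t -> 1 < V r.
  move=> /andP[sr rt]; rewrite ltNge; apply/negP => Vr.
  have : r <= s.
    apply: ub_le_sup; first by exists t.
    by split => //; rewrite rt (le_trans s0 (ltW sr)).
  by rewrite leNgt sr.
have slt : s < t.
  by rewrite lt_neqAle st andbT; apply/eqP => stE; move: Vs; rewrite stE leNgt Vt1.
have [r [sr rt Vr]] : exists r, [/\ s < r, r <= t & V r <= 1].
  have [Vlt|Vge] := ltP (V s) 1.
    have /nbhs_ballP[d /= d0 dV1] : \forall r \near s, V r < 1.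
      exact: (cvgr_lt _ (cV s)).
    exists (Num.min t (s + d / 2)); split.
    - by rewrite lt_min slt ltrDl divr_gt0.
    - by rewrite ge_min lexx.
    - apply/ltW/dV1; rewrite /ball/= distrC ger0_norm ?subr_ge0.
        by rewrite ltrBlDl gt_min ltrD2l ltr_pdivrMr// ltr_pMr// ltr1n orbT.
      by rewrite le_min st lerDl ltW// divr_gt0.
  have /nbhs_ballP[d /= d0 dE] : \forall r \near s, 0 < E r.
    apply: (cvgr_gt _ (cE s)); apply: lt_le_trans (VE _ s0 Vs).
    by rewrite (lt_le_trans _ Vge).
  pose r := Num.min t (s + d / 2).
  have sr : s < r by rewrite lt_min slt ltrDl divr_gt0.
  have rt : r <= t by rewrite ge_min lexx.
  exists r; split => //; apply: le_trans Vs.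
  rewrite -lerN2.
  apply: (@derive_ge0_le _ (fun x => - V x) (fun x => - dV x) s r (ltW sr)).
    by move=> x; apply: cvgN; exact: cV.
  move=> x /andP[sx xr]; have x0 := le_lt_trans s0 sx; split.
    by apply: is_deriveN; exact: dVt.
  rewrite oppr_ge0; apply: (le_trans (dVE _ x0)).
  rewrite oppr_le0; apply/ltW/dE.
  rewrite /ball/= distrC ger0_norm ?subr_ge0; last exact: ltW.
  rewrite ltrBlDl (lt_le_trans xr)// ge_min lerD2l ler_pdivrMr// ler_pMr//.
  by rewrite ler1n orbT.
by have := Ahi r; rewrite sr rt => /(_ isT); rewrite ltNge Vr.
Qed.

(** On the sublevel set V' <= - V, so e^t V(t) is nonincreasing. *)
Lemma confined_decay (V E dV : R -> R) :
  continuous V -> continuous E ->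
  (forall t : R, 0 < t -> is_derive t 1 V (dV t)) ->
  (forall t : R, 0 < t -> dV t <= - E t) ->
  (forall t : R, 0 <= t -> V t <= 1 -> V t <= E t) ->
  V 0 <= 1 -> forall t : R, 0 <= t -> V t <= V 0 * expR (- t).
Proof.
move=> cV cE dVt dVE VE V01 t t0.
have V1 := confined_sublevel cV cE dVt dVE VE V01.
rewrite expRN ler_pdivlMr ?expR_gt0// -lerN2.
pose h s := - (V s * expR s).
have -> : - V 0 = h 0 by rewrite /h expR0 mulr1.
rewrite -[leRHS]/(h t).
pose dh s := - (V s *: expR s + expR s *: dV s).
apply: (@derive_ge0_le _ h dh 0 t t0).
  move=> s; apply: cvgN; apply: cvgM; first exact: cV.
  exact: continuous_expR.
move=> s /andP[s0 _]; split.
  by apply: is_deriveN; apply: is_deriveM; exact: dVt.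
rewrite oppr_ge0 /GRing.scale/= mulrC -mulrDr pmulr_rle0 ?expR_gt0//.
by have := dVE _ s0; have := VE _ (ltW s0) (V1 _ (ltW s0)); lra.
Qed.
End Decay.

(** * Sector condition of constant power loads *)
Section LoadSector.
Context {R : realType}.

(** The bound on v is the larger root of v (v + m) = q / b; beyond it the
    quadratic v (v + m) - q / b is nonnegative. *)
Lemma load_voltage_margin (b q m v : R) : 0 < b -> 0 < q -> m <= 0 ->
  2^-1 * (- m + Num.sqrt (m ^+ 2 + 4 * q / b)) <= v ->
  0 < v + m /\ q <= b * (v * (v + m)).
Proof.
move=> b0 q0 m0 vlb.
have qb0 : 0 < 4 * q / b by rewrite divr_gt0// mulr_gt0.
set r := Num.sqrt _ in vlb.
have r0 : 0 <= r by exact: sqrtr_ge0.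
have rE : r ^+ 2 = m ^+ 2 + 4 * q / b by rewrite sqr_sqrtr// addr_ge0 ?sqr_ge0 ?ltW.
have rm : - m < r.
  rewrite -(@ltr_pXn2r _ 2)// ?nnegrE ?oppr_ge0//.
  by rewrite sqrrN rE ltrDl.
split; first by lra.
have h : q / b <= v * (v + m).
  (* The product of v minus the two roots of v (v + m) - q / b. *)
  have : 0 <= (v - 2^-1 * (- m + r)) * (v + 2^-1 * (m + r)).
    by rewrite mulr_ge0//; lra.
  have : 4 * q / b = 4 * (q / b) by rewrite mulrA.
  by move: rE; rewrite !expr2; nra.
by rewrite mulrC -ler_pdivrMr.
Qed.

(** Write phi = h (s' - v) with s' = max(s, v + m) and h = - p / (v s'); then
    0 <= h <= b because s' >= v + m. If s >= v + m the product is
    h (b - h) (s - v)^2. Otherwise s < s' <= v, and both factors are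
    nonpositive: lowering s below the cutoff moves b (s - v) only further from
    phi. This is why freezing the current preserves the sector condition. *)
Lemma load_sector (b p m v s : R) : 0 < b -> p < 0 -> m <= 0 ->
  0 < v + m -> - p <= b * (v * (v + m)) ->
  0 <= (p / Num.max s (v + m) - p / v) *
       (b * (s - v) - (p / Num.max s (v + m) - p / v)).
Proof.
move=> b0 p0 m0 a0 pb; set phi := p / _ - _.
set a := v + m in a0 pb phi *; have av : a <= v by rewrite /a gerDl.
have v0 : 0 < v := lt_le_trans a0 av.
set s' := Num.max s a in phi *.
have as' : a <= s' by rewrite le_max lexx orbT.
have s'0 : 0 < s' := lt_le_trans a0 as'.
pose h := - p / (v * s').
have phiE : phi = h * (s' - v) by rewrite /phi /h; field; rewrite !gt_eqF.
have h0 : 0 <= h by rewrite divr_ge0 ?oppr_ge0 ?ltW// mulr_gt0.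
have hb : h <= b.
  rewrite ler_pdivrMr ?mulr_gt0//; apply: (le_trans pb).
  by rewrite ler_pM2l// ler_pM2l.
have [sa|as_] := leP a s.
  have -> : s = s' by rewrite /s' max_l.
  rewrite phiE; have -> : h * (s' - v) * (b * (s' - v) - h * (s' - v)) =
    h * (b - h) * (s' - v) ^+ 2 by ring.
  by rewrite mulr_ge0 ?sqr_ge0// mulr_ge0// subr_ge0.
have s'E : s' = a by rewrite /s' max_r// ltW.
rewrite phiE s'E -mulrNN mulr_ge0//; first by rewrite -mulrN mulr_ge0// oppr_ge0 subr_le0.
rewrite oppr_ge0 subr_le0.
apply: (@le_trans _ _ (b * (a - v))); first by rewrite ler_pM2l// lerD2r ltW.
by rewrite -subr_ge0 -mulrBl -mulrNN mulr_ge0// oppr_ge0 subr_le0.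
Qed.

Lemma inv_max_lipschitz (p a s r : R) : 0 < a ->
  `|p / Num.max s a - p / Num.max r a| <= `|p| / a ^+ 2 * `|s - r|.
Proof.
move=> a0.
have ge_a x : a <= Num.max x a by rewrite le_max lexx orbT.
have gt0 x : 0 < Num.max x a := lt_le_trans a0 (ge_a x).
have -> : p / Num.max s a - p / Num.max r a =
    p * (Num.max r a - Num.max s a) / (Num.max s a * Num.max r a).
  by field; rewrite !gt_eqF.
rewrite !normrM normfV (gtr0_norm (mulr_gt0 _ _))// -!mulrA ler_wpM2l//.
rewrite mulrC ler_pM ?invr_ge0// ?(ltW (mulr_gt0 _ _))//.
  by rewrite lef_pV2 ?posrE ?exprn_gt0 ?mulr_gt0// expr2 ler_pM// ltW.
rewrite ler_norml; have := ler_norm (s - r); have := ler_norm (r - s).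
rewrite distrC => h1 h2.
by case: (leP s a) => ?; case: (leP r a) => ?; apply/andP; split; lra.
Qed.

(** The load currents p / s, frozen once a voltage s_k falls below a_k. *)
Definition cutoff_current nl (p a s : 'cV[R]_nl) : 'cV[R]_nl :=
  \col_k (p k 0 / Num.max (s k 0) (a k 0)).

Lemma cutoff_current_lipschitz nl (p a : 'cV[R]_nl) :
  (forall k, p k 0 != 0 -> 0 < a k 0) ->
  exists2 K : R, 0 <= K & forall s r,
    `|cutoff_current p a s - cutoff_current p a r| <= K * `|s - r|.
Proof.
move=> a0; have t0 k : 0 <= `|p k 0| / a k 0 ^+ 2 by rewrite divr_ge0 ?sqr_ge0.
exists (\sum_k `|p k 0| / a k 0 ^+ 2) => [|s r]; first by rewrite sumr_ge0.
apply: ler_mx_norm => [|k j]; first by rewrite mulr_ge0// sumr_ge0.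
rewrite ord1 !mxE; have [->|p0] := eqVneq (p k 0) 0.
  by rewrite !mul0r subrr normr0 mulr_ge0// sumr_ge0.
apply: (le_trans (inv_max_lipschitz _ _ _ (a0 _ p0))).
apply: ler_pM => //; first by rewrite (bigD1 k)//= lerDl sumr_ge0.
by apply: le_trans (ler_coord_norm _ k 0); rewrite !mxE.
Qed.
End LoadSector.

(** * Dissipation inequality from the co-design constraint *)
Section Dissipation.
Context {R : realType} {ns nl nt : nat}.
Local Notation n := (nt + ns + nl)%N.
Local Notation C1 := (loadC R ns nl nt).
Local Notation B1 := (loadB R ns nl nt).

(** The left-hand side is the quadratic form of the co-design matrix at the
    vector (y, phi). The first term is the derivative of y^T P y along
    D y' = A y + B_1 phi; the last one is the sector term that the multiplier
    tau weighs. *)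
Lemma codesign_dissipation (g : microgrid R ns nl nt) (hp : 'cV[R]_nl) (beta : R)
    (z : codesign_var R n) (y : 'cV[R]_n) (phi : 'cV[R]_nl) :
  posdef (cdP z) -> cdPhat z = cdP z *m invmx (mgD g) ->
  loewner_le (codesign_lmi g hp beta z) 0 ->
  2 * (y^T *m cdP z *m (invmx (mgD g) *m (mgA g *m y + B1 *m phi))) 0 0 +
  qform (cdP z) y +
  cdtau z * \sum_k phi k 0 * (beta * hp k 0 * (C1 *m y) k 0 - phi k 0) <= 0.
Proof.
move=> [PT _] PhatE [_ /(_ (col_mx y phi))].
rewrite sub0r /qform mulmxN mulNmx mxE oppr_ge0; apply: le_trans.
rewrite le_eqVlt; apply/orP; left; apply/eqP.
have D (A B : 'M[R]_1) : (A + B) 0 0 = A 0 0 + B 0 0 by rewrite mxE.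
have Z a (A : 'M[R]_1) : (a *: A) 0 0 = a * A 0 0 by rewrite mxE.
have T (A : 'M[R]_1) : A 0 0 = A^T 0 0 by rewrite mxE.
rewrite /codesign_lmi tr_col_mx mul_row_block mul_row_col.
set c := 2^-1 * beta * cdtau z.
rewrite !mulmxDl !mulmxDr !mulmxDl !mulmxN !mulNmx !D.
rewrite -?scalemxAl -?scalemxAr -?scalemxAl !Z.
have e1 : (y^T *m (mgA g)^T *m (cdPhat z)^T *m y) 0 0 =
    (y^T *m cdPhat z *m mgA g *m y) 0 0.
  by rewrite T !trmx_mul !trmxK !mulmxA.
have e2 : (phi^T *m B1^T *m (cdPhat z)^T *m y) 0 0 =
    (y^T *m cdPhat z *m B1 *m phi) 0 0.
  by rewrite T !trmx_mul !trmxK !mulmxA.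
have e3 : (y^T *m C1^T *m vdiag hp *m phi) 0 0 =
    (phi^T *m vdiag hp *m C1 *m y) 0 0.
  by rewrite T !trmx_mul !trmxK tr_diag_mx !mulmxA.
have e4 : (phi^T *m vdiag hp *m C1 *m y) 0 0 =
    \sum_k phi k 0 * (hp k 0 * (C1 *m y) k 0).
  rewrite -!mulmxA mxE; apply: eq_bigr => k _.
  by rewrite mul_diag_mx !mxE.
have e5 : (phi^T *m phi) 0 0 = \sum_k phi k 0 ^+ 2.
  by rewrite mxE; apply: eq_bigr => k _; rewrite mxE expr2.
have N (A : 'M[R]_1) : (- A) 0 0 = - A 0 0 by rewrite mxE.
rewrite mul_mx_scalar -scalemxAl N Z !mulmxA e1 e2 e3 e4 e5 PhatE !mulmxA.
rewrite (_ : \sum_k _ = beta * (\sum_k phi k 0 * (hp k 0 * (C1 *m y) k 0)) -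
    \sum_k phi k 0 ^+ 2); first by rewrite /c; field.
rewrite mulr_sumr -sumrB; apply: eq_bigr => k _.
by ring.
Qed.
End Dissipation.

(** * Stability of the microgrid *)
Section Certificate.
Context {R : realType} {ns nl nt : nat}.
Local Notation n := (nt + ns + nl)%N.
Local Notation C1 := (loadC R ns nl nt).
Local Notation B1 := (loadB R ns nl nt).
Implicit Types (g : microgrid R ns nl nt) (u : 'cV[R]_ns) (P : 'M[R]_n).

Lemma mgD_unitmx g : mgD g \in unitmx.
Proof.
have /diag_mxP[d dE] := mgD_diag g.
rewrite dE unitmxE det_diag unitfE; apply/prodf_neq0 => i _.
by have := mgD_pos g i; rewrite dE mxE eqxx mulr1n => /gt_eqF ->.
Qed.

(** The ellipsoid of a positive definite matrix is bounded, so the infimum is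
    that of a set bounded from below. *)
Lemma load_dev_inf_le P (k : 'I_nl) y : posdef P -> qform P y <= 1 ->
  load_dev_inf P k 0 <= (C1 *m y) k 0.
Proof.
move=> Ppd Vy; rewrite mxE; apply: ge_inf; last by exists y.
have [c c0 cP] := posdef_norm_bound Ppd; have [K K0 KP] := mulmx_bound C1.
exists (- (K * Num.sqrt c)) => _ [x Vx <-].
rewrite lerNl; apply: (le_trans (ler_norm _)); rewrite normrN.
apply: (le_trans (ler_coord_norm _ _ _)); apply: (le_trans (KP _)).
rewrite ler_wpM2l// -[leLHS]ger0_norm// -sqrtr_sqr ler_wsqrtr//.
by apply: (le_trans (cP _)); rewrite ger_pMr.
Qed.

Lemma load_dev_inf_le0 P k : posdef P -> load_dev_inf P k 0 <= 0.
Proof.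
move=> Ppd; have := @load_dev_inf_le P k 0 Ppd.
by rewrite /qform !mulmx0 !mxE; apply; exact: ler01.
Qed.

Lemma cutoff_current_id (p a s : 'cV[R]_nl) : vle a s ->
  cutoff_current p a s = vdiv p s.
Proof. by move=> as_; apply/colP => k; rewrite !mxE max_l. Qed.

(** The deviation of the cut off load currents from their values at the voltages
    v lies in the sector [0, b], at every s and not only for s >= a. *)
Definition sector_bounded (p v a b : 'cV[R]_nl) :=
  forall s : 'cV[R]_nl, let phi := cutoff_current p a s - vdiv p v in
  forall k, 0 <= phi k 0 * (b k 0 * (s k 0 - v k 0) - phi k 0).

Lemma load_voltage_lb_sector g (hp v : 'cV[R]_nl) beta P :
  posdef P -> vpos hp -> 0 < beta -> vle (load_voltage_lb g hp beta P) v ->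
  (forall k, mgpl g k 0 != 0 -> 0 < (v + load_dev_inf P) k 0) /\
  sector_bounded (mgpl g) v (v + load_dev_inf P) (beta *: hp).
Proof.
move=> Ppd hp0 b0 vlb.
have key k : mgpl g k 0 != 0 -> mgpl g k 0 < 0 /\
    (0 < v k 0 + load_dev_inf P k 0 /\ - mgpl g k 0 <=
       beta * hp k 0 * (v k 0 * (v k 0 + load_dev_inf P k 0))).
  move=> pk; have p0 : mgpl g k 0 < 0.
    by rewrite lt_neqAle pk; have := mgpl_le0 g k; rewrite mxE.
  split => //; apply: load_voltage_margin.
  - exact: mulr_gt0.
  - by rewrite oppr_gt0.
  - exact: load_dev_inf_le0.
  - by have := vlb k; rewrite [X in X <= _]mxE mulrN mulNr.
have m0 k := load_dev_inf_le0 k Ppd.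
move: (load_dev_inf P) key m0 => m key m0.
split=> [k /key[_ [+ _]]|s phi k]; first by rewrite mxE.
rewrite /phi !mxE; have [->|/key[p0 [a0 pb]]] := eqVneq (mgpl g k 0) 0.
  by rewrite !mul0r subrr mul0r.
by apply: load_sector => //; exact: mulr_gt0.
Qed.

(** Stated for a time-dependent load current [cur] that is known to be the cut
    off current only while x is in the ellipsoid. This covers both the solutions
    of the cut off system and the trajectories of the microgrid itself. *)
Lemma cutoff_solution_decay g u hp beta (z : codesign_var R n) xe a
    (x : R -> 'cV[R]_n) (cur : R -> 'cV[R]_nl) :
  posdef (cdP z) -> 0 < cdtau z -> cdPhat z = cdP z *m invmx (mgD g) ->
  loewner_le (codesign_lmi g hp beta z) 0 -> mg_rhs g u xe = 0 ->
  sector_bounded (mgpl g) (C1 *m xe) a (beta *: hp) ->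
  continuous x -> continuous cur ->
  (forall t : R, 0 < t -> is_derive t 1 x (invmx (mgD g) *m
     (mgA g *m x t + mgB2 g *m vdiv u (mgRs g) + B1 *m cur t))) ->
  (forall t : R, 0 <= t -> qform (cdP z) (x t - xe) <= 1 ->
     cur t = cutoff_current (mgpl g) a (C1 *m x t)) ->
  qform (cdP z) (x 0 - xe) <= 1 -> forall t : R, 0 <= t ->
  qform (cdP z) (x t - xe) <= qform (cdP z) (x 0 - xe) * expR (- t).
Proof.
move=> Ppd tau0 PhatE lmi eqxe sec cx ccur dx curE V0.
pose y t := x t - xe.
pose phi t := cur t - vdiv (mgpl g) (C1 *m xe).
(* V' <= - (V + tau S), and S >= 0 inside the ellipsoid by the sector condition. *)
pose S t := \sum_k phi t k 0 * (beta * hp k 0 * (C1 *m y t) k 0 - phi t k 0).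
pose dy t := invmx (mgD g) *m (mgA g *m y t + B1 *m phi t).
have cy : continuous y by move=> t; apply: cvgB; [exact: cx|exact: cvg_cst].
have cphi : continuous phi by move=> t; apply: cvgB; [exact: ccur|exact: cvg_cst].
have cV : continuous (fun t => qform (cdP z) (y t)).
  by move=> t; exact: (@continuous_qform _ _ _ (cdP z) y t (cy t)).
have dyt (t : R) : 0 < t -> is_derive t 1 y (dy t).
  move=> t0; have := is_deriveB (dx _ t0) (is_derive_cst xe t 1).
  rewrite subr0; congr (is_derive _ _ _ (_ *m _)).
  rewrite /y /phi !mulmxBr -[LHS]subr0 -eqxe /mg_rhs.
  by rewrite opprD addrACA opprD [X in X + _ = _]addrACA subrr addr0.
have cS : continuous S.
  move=> t; apply: cvg_sum => k.
  have cphik := @continuous_coord _ _ _ _ phi t k 0 (cphi t).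
  apply: cvgM; first exact: cphik.
  apply: cvgB; last exact: cphik.
  apply: cvgM; first exact: cvg_cst.
  exact: (@continuous_coord _ _ _ _ _ t k 0 (continuous_mulmx (A := C1) (cy t))).
have S0 t : 0 <= t -> qform (cdP z) (y t) <= 1 -> 0 <= S t.
  move=> t0 Vt; apply: sumr_ge0 => k _.
  have := sec (C1 *m x t) k; rewrite -(curE _ t0 Vt) -/(phi t).
  by rewrite [(beta *: hp) k 0]mxE -/(y t) mulmxBr [X in _ -> _ <= _ * (_ * X - _)]mxE
    [X in _ -> _ <= _ * (_ * (_ + X) - _)]mxE.
apply: (@confined_decay _ (fun t => qform (cdP z) (y t))
  (fun t => qform (cdP z) (y t) + cdtau z * S t)
  (fun t => 2 * ((y t)^T *m cdP z *m dy t) 0 0)) => //.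
- move=> t; apply: cvgD; first exact: cV.
  by apply: cvgM; [exact: cvg_cst|exact: cS].
- by move=> t /dyt; apply: is_derive_qform; case: Ppd.
- move=> t t0; have := codesign_dissipation (y t) (phi t) Ppd PhatE lmi.
  by rewrite -/(dy t) -/(S t); lra.
- by move=> t t0 Vt; rewrite lerDl mulr_ge0 ?S0// ltW.
Qed.

Lemma trajectory_clamp g u x0 (x : R -> 'cV[R]_n) : trajectory g u x0 x ->
  exists xc : R -> 'cV[R]_n,
  [/\ continuous xc, forall t : R, 0 <= t -> xc t = x t,
      forall t, mg_domain g (xc t) &
      forall t : R, 0 < t ->
        is_derive t 1 xc (invmx (mgD g) *m mg_rhs g u (xc t))].
Proof.
move=> [x00 cx domx dx]; exists (fun t => x (Num.max t 0)).
have max0 (t : R) : 0 <= Num.max t 0 by rewrite le_max lexx orbT.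
have xE (t : R) : 0 <= t -> x (Num.max t 0) = x t by move=> t0; rewrite max_l.
split; [|exact: xE|by move=> t; exact: domx|].
- move=> t; set A := [set` _] in cx.
  have At : A (Num.max t 0) by rewrite /A/= in_itv/= max0.
  have := cx (Num.max t 0); rewrite /continuous_at => cxt.
  apply: cvg_trans cxt => U h.
  have {}h : within A (nbhs (Num.max t 0)) (x @^-1` U).
    by rewrite nbhs_subspace_in//; exact: h.
  have : \forall s \near t, A (Num.max s 0) -> U (x (Num.max s 0)).
    exact: (@continuous_clamp R t _ h).
  by apply: filterS => s; apply; rewrite /A/= in_itv/= max0.
- move=> t t0; rewrite (xE _ (ltW t0)); have [dxt Dxt] := dx _ t0.
  apply: (@near_eq_is_derive _ _ _ x).
    by near=> s; rewrite -(near (near_clamp t0) s).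
  rewrite -Dxt (mulKmx (mgD_unitmx g)) derive1E.
  exact: (DeriveDef dxt erefl).
Unshelve. all: by end_near. Qed.

Section CertifiedEquilibrium.
Context (g : microgrid R ns nl nt) (u : 'cV[R]_ns) (hp : 'cV[R]_nl) (beta : R).
Context (z : codesign_var R n) (xe : 'cV[R]_n).
Let P := cdP z.
Let a := C1 *m xe + load_dev_inf P.
Context (Ppd : posdef P) (tau0 : 0 < cdtau z)
  (PhatE : cdPhat z = P *m invmx (mgD g))
  (lmi : loewner_le (codesign_lmi g hp beta z) 0)
  (eqxe : mg_rhs g u xe = 0)
  (a0 : forall k, mgpl g k 0 != 0 -> 0 < a k 0)
  (sec : sector_bounded (mgpl g) (C1 *m xe) a (beta *: hp)).

Lemma cutoff_le_load x : qform P (x - xe) <= 1 -> vle a (C1 *m x).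
Proof.
move=> Vx k; have := load_dev_inf_le k Ppd Vx.
rewrite mulmxBr [X in _ <= X]mxE [X in _ <= _ + X]mxE lerBrDl => h.
by rewrite [X in X <= _]mxE.
Qed.

Lemma trajectory_decay x0 x : trajectory g u x0 x -> qform P (x0 - xe) <= 1 ->
  forall t : R, 0 <= t ->
  qform P (x t - xe) <= qform P (x0 - xe) * expR (- t).
Proof.
move=> trx V0 t t0; have [x00 _ _ _] := trx.
have [xc [cxc xcE dom dxc]] := trajectory_clamp trx.
have ccur : continuous (fun t => vdiv (mgpl g) (C1 *m xc t)).
  (* The domain condition excludes zero voltages except at loads with p = 0. *)
  move=> s.
  rewrite (_ : (fun t => _) = fun t => \col_k (mgpl g k 0 / (C1 *m xc t) k 0)); last first.
    by apply/funext => r; apply/colP => k; rewrite [LHS]mxE [RHS]mxE.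
  apply: continuous_col => k.
  have [->|pk] := eqVneq (mgpl g k 0) 0.
    rewrite (_ : (fun _ => _) = cst 0); first exact: cvg_cst.
    by apply/funext => r; rewrite mul0r.
  apply: cvgM; first exact: cvg_cst.
  apply: cvgV; first exact: dom.
  exact: (@continuous_coord _ _ _ _ _ s k 0 (continuous_mulmx (A := C1) (cxc s))).
have := cutoff_solution_decay Ppd tau0 PhatE lmi eqxe sec cxc ccur dxc.
rewrite (xcE 0)// x00 -(xcE t)//; apply => // s s0 Vs.
by rewrite cutoff_current_id//; exact: cutoff_le_load.
Qed.

(** A solution of the system with cut off currents stays in the ellipsoid, where
    no load voltage is below the cutoff. *)
Lemma trajectory_exists x0 : qform P (x0 - xe) <= 1 ->
  exists x, trajectory g u x0 x.
Proof.
move=> V0.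
pose f x := invmx (mgD g) *m (mgA g *m x + mgB2 g *m vdiv u (mgRs g) +
  B1 *m cutoff_current (mgpl g) a (C1 *m x)).
have [Kc Kc0 KcP] := cutoff_current_lipschitz a0.
have [KD KD0 KDP] := mulmx_bound (invmx (mgD g)).
have [KA KA0 KAP] := mulmx_bound (mgA g).
have [KB KB0 KBP] := mulmx_bound B1.
have [KC KC0 KCP] := mulmx_bound C1.
have fL x y : `|f x - f y| <= KD * (KA + KB * Kc * KC) * `|x - y|.
  rewrite /f -mulmxBr; apply: (le_trans (KDP _)).
  rewrite -mulrA ler_wpM2l// opprD addrACA opprD [X in `|X + _|]addrACA subrr addr0.
  rewrite -!mulmxBr mulrDl; apply: (le_trans (ler_normD _ _)).
  rewrite lerD//; apply: (le_trans (KBP _)); rewrite -!mulrA ler_wpM2l//.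
  apply: (le_trans (KcP _ _)); rewrite ler_wpM2l// -mulmxBr.
  exact: KCP.
have [x [cx x00 dx]] := lipschitz_global_solution fL x0.
have ccur : continuous (fun t => cutoff_current (mgpl g) a (C1 *m x t)).
  move=> t.
  apply: (@lipschitz_comp_continuous _ _ _ _ _ _ (fun s => C1 *m x s) t KcP).
  exact: (continuous_mulmx (A := C1) (cx t)).
have Vx t : 0 <= t -> qform P (x t - xe) <= 1.
  move=> t0.
  have := cutoff_solution_decay Ppd tau0 PhatE lmi eqxe sec cx ccur dx.
  rewrite x00 => /(_ _ V0 _ t0)/le_trans; apply => //.
  have := qform_ge0 (x0 - xe) Ppd => V0'.
  apply: (le_trans _ V0); rewrite ler_piMr// -expR0 ler_expR oppr_le0//.
have ax t : 0 <= t -> vle a (C1 *m x t) by move=> /Vx; exact: cutoff_le_load.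
exists x; split => //.
- exact: continuous_subspaceT.
- move=> t t0 k pk; rewrite gt_eqF// (lt_le_trans (a0 pk))//.
  exact: ax.
- move=> t t0; have [dxt Dxt] := dx _ t0; split; first exact: dxt.
  rewrite derive1E Dxt /f mulKVmx ?mgD_unitmx// cutoff_current_id//.
  exact/ax/ltW.
Qed.

Lemma ellipsoid_sub_roa x0 : qform P (x0 - xe) <= 1 ->
  region_of_attraction g u xe x0.
Proof.
move=> V0; split; first exact: trajectory_exists.
move=> x trx; have [c c0 cP] := posdef_norm_bound Ppd.
have decay := trajectory_decay trx V0.
apply/cvgrPdist_le => e e0.
have : \forall t \near +oo, expR (- t) <= e ^+ 2 / c :> R.
  have := @cvgr_expR R => /cvgrPdist_le/(_ (e ^+ 2 / c)).
  rewrite divr_gt0 ?exprn_gt0// => /(_ isT); apply: filterS => t.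
  by rewrite sub0r normrN ger0_norm// expR_ge0.
move=> small; near=> t.
have t0 : 0 <= t by near: t; exact: nbhs_pinfty_ge.
rewrite distrC -(@ler_pXn2r _ 2)// ?nnegrE ?(ltW e0)//.
apply: (le_trans (cP _)); rewrite mulrC -ler_pdivlMr//.
apply: (le_trans (decay _ t0)).
apply: (@le_trans _ _ (expR (- t))); last by near: t.
by rewrite ler_piMl// expR_ge0.
Unshelve. all: by end_near. Qed.

(** V is equivalent to the squared norm and does not increase, which gives
    stability; the ellipsoid is a neighbourhood of xe in the region of
    attraction. *)
Lemma ellipsoid_asymptotic_stability : mg_domain g xe ->
  asymptotically_stable g u xe.
Proof.
move=> domxe; have [c c0 cP] := posdef_norm_bound Ppd.
have [C C0 CP] := qform_norm_bound P.
split; first by split.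
- move=> e e0; pose d := Num.min (Num.sqrt (C^-1)) (e / (2 * Num.sqrt (c * C))).
  have cC0 : 0 < c * C by exact: mulr_gt0.
  have d0 : 0 < d.
    by rewrite lt_min sqrtr_gt0 invr_gt0 C0/= divr_gt0// mulr_gt0// sqrtr_gt0.
  exists d => // x0 x; rewrite -ball_normE/= => x0d trx t t0.
  have V0 : qform P (x0 - xe) <= C * d ^+ 2.
    apply: (le_trans (CP _)); rewrite ler_pM2l// lerXn2r ?nnegrE ?(ltW d0)//.
    by rewrite distrC ltW.
  have V1 : qform P (x0 - xe) <= 1.
    apply: (le_trans V0); rewrite -ler_pdivlMl// mulr1.
    rewrite -[leRHS]sqr_sqrtr ?invr_ge0 ?(ltW C0)//.
    by rewrite lerXn2r ?nnegrE ?sqrtr_ge0 ?(ltW d0)// ge_min lexx.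
  rewrite distrC -(@ltr_pXn2r _ 2)// ?nnegrE ?(ltW e0)//.
  apply: (le_lt_trans (cP _)).
  apply: (@le_lt_trans _ _ (c * (C * d ^+ 2))).
    rewrite ler_pM2l//; apply: (le_trans (trajectory_decay trx V1 t0)).
    apply: le_trans V0; rewrite ler_piMr ?qform_ge0//.
    by rewrite -expR0 ler_expR oppr_le0.
  have de : d <= e / (2 * Num.sqrt (c * C)) by rewrite ge_min lexx orbT.
  apply: (@le_lt_trans _ _ (c * C * (e / (2 * Num.sqrt (c * C))) ^+ 2)).
    rewrite mulrA ler_pM2l// lerXn2r ?nnegrE ?(ltW d0)//.
    by rewrite divr_ge0 ?(ltW e0)// mulr_ge0// sqrtr_ge0.
  rewrite expr_div_n exprMn sqr_sqrtr ?(ltW cC0)//.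
  have -> : c * C * (e ^+ 2 / (2 ^+ 2 * (c * C))) = e ^+ 2 / 4.
    by field; rewrite !gt_eqF.
  by rewrite ltr_pdivrMr// ltr_pMr ?exprn_gt0// ltr1n.
- apply/nbhs_ballP; exists (Num.sqrt C^-1) => /=; first by rewrite sqrtr_gt0 invr_gt0.
  move=> x0; rewrite -ball_normE/= => x0d; apply: ellipsoid_sub_roa.
  apply: (le_trans (CP _)); rewrite -ler_pdivlMl// mulr1.
  rewrite -[leRHS]sqr_sqrtr ?invr_ge0 ?(ltW C0)//.
  by rewrite lerXn2r ?nnegrE ?sqrtr_ge0// distrC ltW.
Qed.
End CertifiedEquilibrium.

(** All vertices of the box give the same value to the diagonal form [gamma],
    and this value is its maximum on the box; hence one vertex suffices. *)
Lemma box_sub_ellipsoid (dxbar : 'cV[R]_n) (k : {ffun 'I_n -> bool}) P gam xe x0 :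
  vpos gam -> qform (vdiag gam) (box_vertex dxbar k) <= 1 ->
  loewner_le P (vdiag gam) -> vbox (xe - dxbar) (xe + dxbar) x0 ->
  qform P (x0 - xe) <= 1.
Proof.
move=> gam0 vert [_ /(_ (x0 - xe))].
have -> y : qform (vdiag gam - P) y = qform (vdiag gam) y - qform P y.
  by rewrite /qform mulmxBr mulmxBl mxE [X in _ + X]mxE.
rewrite subr_ge0 => PG [lo hi].
apply: (le_trans PG); apply: le_trans vert.
rewrite !qform_vdiag; apply: ler_sum => i _.
rewrite ler_pM2l; last exact: gam0.
rewrite [box_vertex _ _ _ _]mxE exprMn sqrr_sign mul1r.
rewrite -ler_sqrt ?sqr_ge0// !sqrtr_sqr.
apply: le_trans (ler_norm _); have := lo i; have := hi i; rewrite !mxE ler_norml.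
by move=> h1 h2; apply/andP; split; lra.
Qed.
End Certificate.

Theorem theorem1 (R : realType) (ns nl nt : nat)
    (g : microgrid R ns nl nt) (sd : synthesis_data R ns nl nt)
    (dxbar : 'cV[R]_(nt + ns + nl)) (hp : 'cV[R]_nl)
    (k : {ffun 'I_(nt + ns + nl) -> bool}) (tried : seq R) (beta : R)
    (z : codesign_var R (nt + ns + nl))
    (u : 'cV[R]_ns) (xe : 'cV[R]_(nt + ns + nl))
    (vl : 'cV[R]_nl) (ps : 'cV[R]_ns) :
  vpos dxbar -> vpos hp ->
  line_search_result g dxbar hp k tried beta ->
  codesign_solution g dxbar hp k beta z ->
  synthesis_feasible g sd (load_voltage_lb g hp beta (cdP z)) u xe vl ps ->
  equilibrium g u xe ->
  transiently_stable g u xe (vbox (xe - dxbar) (xe + dxbar)).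
Proof.
move=> _ hp0 [_ [beta0 _] _] [[[Ppd gam0 tau0] [vert PG PhatE lmi]] _].
move=> [_ [_ _ _ vlb]] [domxe eqxe].
have [a0 sec] := load_voltage_lb_sector Ppd hp0 beta0 vlb.
split; first exact: ellipsoid_asymptotic_stability lmi eqxe a0 sec domxe.
move=> x0 x0box; apply: (ellipsoid_sub_roa Ppd tau0 PhatE lmi eqxe a0 sec).
exact: box_sub_ellipsoid vert PG x0box.
Qed.
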